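(* There exists an OGSL[3-ag, fvs, 2-alt] sentence having no ATL$^*$ equivalent, i.e., there is an OGSL sentence $\varphi$ over three agents, in which each variable is bound to at most one agent and whose subformulas have alternation number at most $2$, such that for every ATL$^*$ formula $\varphi'$ there are a CGS $\mathcal{G}$ (with initial state $s_0$) on which $\varphi$ and $\varphi'$ have different truth values at $s_0$.
   Context: A concurrent game structure (CGS) is $\langle \mathrm{AP}, \mathrm{Ag}, \mathrm{Ac}, \mathrm{St}, \lambda, \tau, s_0\rangle$: finite non-empty atomic propositions and agents, non-empty actions and states, initial state $s_0$, labeling $\lambda:\mathrm{St}\to2^{\mathrm{AP}}$, transition $\tau:\mathrm{St}\times\mathrm{Ac}^{\mathrm{Ag}}\to\mathrm{St}$. Tracks: finite non-empty state sequences whose consecutive states are $\tau$-related under some decision; $\mathrm{Trk}(s)$ those starting at $s$. Strategies: partial maps tracks$\to\mathrm{Ac}$; $\mathrm{Str}(s)$ those defined exactly on $\mathrm{Trk}(s)$. Assignments: partial maps $\mathrm{Var}\cup\mathrm{Ag}\to$ strategies; complete if defined on all agents. Translation $(f)_\rho(\rho')=f(\rho\cdot\rho'_{\ge1})$; $\mathrm{play}(\chi,s)$ is the path $\pi$ with $\pi_0=s$, $\pi_{i+1}=\tau(\pi_i,d_i)$, $d_i(a)=\chi(a)(\pi_0\cdots\pi_i)$; $(\chi,s)^i=((\chi)_{\pi_0\cdots\pi_i},\pi_i)$. SL syntax $\varphi ::= p\mid\neg\varphi\mid\varphi\wedge\varphi\mid\varphi\vee\varphi\mid X\varphi\mid\varphi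 U\varphi\mid\varphi R\varphi\mid\langle\langle x\rangle\rangle\varphi\mid[[x]]\varphi\mid(a,x)\varphi$; free agents/variables: atoms none; Boolean union; $X,U,R$ add all agents; quantifiers on $x$ remove $x$; $(a,x)\varphi$: $\mathrm{free}(\varphi)$ if $a\notin\mathrm{free}(\varphi)$, else $(\mathrm{free}(\varphi)\setminus\{a\})\cup\{x\}$; sentence: nothing free. Semantics: $p$ iff $p\in\lambda(s)$; Boolean usual; $\langle\langle x\rangle\rangle\varphi$/$[[x]]\varphi$: some/all $f\in\mathrm{Str}(s)$ satisfy $\mathcal{G},\chi[x\mapsto f],s\models\varphi$; $(a,x)\varphi$ iff $\mathcal{G},\chi[a\mapsto\chi(x)],s\models\varphi$; $X,U,R$ for complete $\chi$ as in LTL along $(\chi,s)^i$; $\mathcal{G}\models\varphi$ iff $\mathcal{G},\emptyset,s_0\models\varphi$. Quantification prefix over finite $V\subseteq\mathrm{Var}$: word over $\{\langle\langle x\rangle\rangle,[[x]]:x\in V\}$ with each $x\in V$ exactly once ($\mathrm{Qnt}(V)$); binding prefix: word of length $|\mathrm{Ag}|$ over pairs $(a,x)$ with each agent exactly once. OGSL: $\varphi ::= p\mid\neg\varphi\mid\varphi\wedge\varphi\mid\varphi\vee\varphi\mid X\varphi\mid\varphi U\varphi\mid\varphi R\varphi\mid\wp\flat\varphi$ with $\flat$ a binding prefix and $\wp\in\mathrm{Qnt}(\mathrm{free}(\flat\varphi))$. ''3-ag'' means $|\mathrm{Ag}|=3$; ''fvs'' means no variable is bound to two different agents; ''2-alt''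 means every subformula has alternation number $\le 2$ (number of quantifier switches binding variables in non-sentence subformulas, subsentences treated as atoms, vacuous quantifications ignored). ATL$^*$: state formulas $\phi ::= p\mid\neg\phi\mid\phi\wedge\phi\mid\langle\langle A\rangle\rangle\psi$ ($A\subseteq\mathrm{Ag}$), path formulas $\psi$ are LTL formulas over state formulas; $\langle\langle A\rangle\rangle\psi$ holds at $s$ iff there are strategies in $\mathrm{Str}(s)$ for the agents of $A$ such that for all strategies in $\mathrm{Str}(s)$ of the other agents the resulting play satisfies $\psi$. *)

(* Defs.v *)
From HB Require Import structures.
From mathcomp Require Import all_boot finmap boolp.

Set Implicit Arguments.
Unset Strict Implicit.
Unset Printing Implicit Defensive.

Local Open Scope fset_scope.

(** * Concurrent game structures over the propositions AP and the agents Ag *)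

(* [ac0] and [s0] witness that actions and states are non-empty. *)
Record CGS (AP Ag : finType) := MkCGS {
  Ac : Type;
  St : Type;
  ac0 : Ac;
  lab : St -> {set AP};
  trans : St -> {ffun Ag -> Ac} -> St;
  s0 : St
}.

Fixpoint steps (AP Ag : finType) (G : CGS AP Ag) (s : St G) (p : seq (St G))
    : Prop :=
  if p is s' :: p' then (exists d, trans s d = s') /\ steps s' p' else True.

Definition Trk (AP Ag : finType) (G : CGS AP Ag) (s : St G) (rho : seq (St G))
    : Prop :=
  if rho is s' :: p then s' = s /\ steps s' p else False.

(* Partial maps on tracks, encoded as partial maps on all state sequences; the
   members of [Str s] are undefined on every sequence that is not a track. *)
Definition strategy (AP Ag : finType) (G : CGS AP Ag) : Type :=
  seq (St G) -> option (Ac G).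

Definition Str (AP Ag : finType) (G : CGS AP Ag) (s : St G) (f : strategy G)
    : Prop :=
  forall rho, (exists c, f rho = Some c) <-> Trk s rho.

(* (f)_rho, a partial map whose domain consists of tracks that start at the
   last state of rho; rho is non-empty in every use. *)
Definition translate (AP Ag : finType) (G : CGS AP Ag) (rho : seq (St G))
    (f : strategy G) : strategy G :=
  fun rho' =>
    if rho is s :: p then
      if `[< Trk (last s p) rho' >] then f (rho ++ behead rho') else None
    else None.

Notation var := nat (only parsing).

Definition assignment (AP Ag : finType) (G : CGS AP Ag) : Type :=
  (var + Ag)%type -> option (strategy G).

Definition empty_asg (AP Ag : finType) (G : CGS AP Ag) : assignment G :=
  fun=> None.

Definition upd (AP Ag : finType) (G : CGS AP Ag) (chi : assignment G)
    (l : (var + Ag)%type) (f : option (strategy G)) : assignment G :=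
  fun l' => if l' == l then f else chi l'.

(* The default [ac0] is used only where chi(a)(rho) is undefined, which does
   not happen along the plays of a complete assignment into [Str s]. *)
Definition decision (AP Ag : finType) (G : CGS AP Ag) (chi : assignment G)
    (rho : seq (St G)) : {ffun Ag -> Ac G} :=
  [ffun a => odflt (ac0 G) (obind (fun f : strategy G => f rho) (chi (inr a)))].

(* The track pi_0 ... pi_i of the play pi. *)
Fixpoint play_prefix (AP Ag : finType) (G : CGS AP Ag) (chi : assignment G)
    (s : St G) (i : nat) : seq (St G) :=
  if i is j.+1 then
    let rho := play_prefix chi s j in
    rcons rho (trans (last s rho) (decision chi rho))
  else [:: s].

Definition play (AP Ag : finType) (G : CGS AP Ag) (chi : assignment G)
    (s : St G) (i : nat) : St G :=
  last s (play_prefix chi s i).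

(* First component of (chi, s)^i; the second one is [play chi s i]. *)
Definition shift (AP Ag : finType) (G : CGS AP Ag) (chi : assignment G)
    (s : St G) (i : nat) : assignment G :=
  fun l => omap (translate (play_prefix chi s i)) (chi l).

(** * Strategy Logic *)

(* [SLQ true x] is <<x>> and [SLQ false x] is [[x]]. *)
Inductive SL (AP Ag : finType) : Type :=
| SLAtom of AP
| SLNot of SL AP Ag
| SLAnd of SL AP Ag & SL AP Ag
| SLOr of SL AP Ag & SL AP Ag
| SLX of SL AP Ag
| SLU of SL AP Ag & SL AP Ag
| SLR of SL AP Ag & SL AP Ag
| SLQ of bool & var & SL AP Ag
| SLBind of Ag & var & SL AP Ag.

Arguments SLAtom {AP Ag}.

Definition all_agents (Ag : finType) : {fset (var + Ag)} :=
  [fset inr a | a in enum Ag].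

Fixpoint free (AP Ag : finType) (phi : SL AP Ag) : {fset (var + Ag)} :=
  match phi with
  | SLAtom _ => fset0
  | SLNot phi1 => free phi1
  | SLAnd phi1 phi2 | SLOr phi1 phi2 => free phi1 `|` free phi2
  | SLX phi1 => all_agents Ag `|` free phi1
  | SLU phi1 phi2 | SLR phi1 phi2 => all_agents Ag `|` (free phi1 `|` free phi2)
  | SLQ _ x phi1 => free phi1 `\ inl x
  | SLBind a x phi1 =>
      if inr a \in free phi1 then inl x |` (free phi1 `\ inr a) else free phi1
  end.

Definition sentence (AP Ag : finType) (phi : SL AP Ag) : bool :=
  free phi == fset0.

Fixpoint sat (AP Ag : finType) (G : CGS AP Ag) (phi : SL AP Ag)
    (chi : assignment G) (s : St G) : Prop :=
  match phi with
  | SLAtom p => p \in lab s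
  | SLNot phi1 => ~ sat phi1 chi s
  | SLAnd phi1 phi2 => sat phi1 chi s /\ sat phi2 chi s
  | SLOr phi1 phi2 => sat phi1 chi s \/ sat phi2 chi s
  | SLX phi1 => sat phi1 (shift chi s 1) (play chi s 1)
  | SLU phi1 phi2 =>
      exists i, sat phi2 (shift chi s i) (play chi s i) /\
        forall j, j < i -> sat phi1 (shift chi s j) (play chi s j)
  | SLR phi1 phi2 =>
      forall i, sat phi2 (shift chi s i) (play chi s i) \/
        exists2 j, j < i & sat phi1 (shift chi s j) (play chi s j)
  | SLQ true x phi1 =>
      exists f, Str s f /\ sat phi1 (upd chi (inl x) (Some f)) s
  | SLQ false x phi1 =>
      forall f, Str s f -> sat phi1 (upd chi (inl x) (Some f)) s
  | SLBind a x phi1 => sat phi1 (upd chi (inr a) (chi (inl x))) s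
  end.

Definition models (AP Ag : finType) (G : CGS AP Ag) (phi : SL AP Ag) : Prop :=
  sat phi (@empty_asg AP Ag G) (s0 G).

(** * The fragment OGSL[fvs, k-alt] *)

Definition quants (AP Ag : finType) (w : seq (bool * var)) (phi : SL AP Ag)
    : SL AP Ag :=
  foldr (fun q psi => SLQ q.1 q.2 psi) phi w.

Definition binds (AP Ag : finType) (b : seq (Ag * var)) (phi : SL AP Ag)
    : SL AP Ag :=
  foldr (fun c psi => SLBind c.1 c.2 psi) phi b.

(* Qnt(V), for V regarded as a subset of Var + Ag; it is empty when V contains
   an agent. *)
Definition Qnt (Ag : finType) (V : {fset (var + Ag)}) (w : seq (bool * var))
    : Prop :=
  uniq (unzip2 w) /\ V = [fset inl x | x in unzip2 w].

Definition binding_prefix (Ag : finType) (b : seq (Ag * var)) : Prop :=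
  size b = #|Ag| /\ forall a, count_mem a (unzip1 b) = 1.

Inductive OGSL (AP Ag : finType) : SL AP Ag -> Prop :=
| OGSL_Atom p : OGSL (SLAtom p)
| OGSL_Not phi : OGSL phi -> OGSL (SLNot phi)
| OGSL_And phi1 phi2 : OGSL phi1 -> OGSL phi2 -> OGSL (SLAnd phi1 phi2)
| OGSL_Or phi1 phi2 : OGSL phi1 -> OGSL phi2 -> OGSL (SLOr phi1 phi2)
| OGSL_X phi : OGSL phi -> OGSL (SLX phi)
| OGSL_U phi1 phi2 : OGSL phi1 -> OGSL phi2 -> OGSL (SLU phi1 phi2)
| OGSL_R phi1 phi2 : OGSL phi1 -> OGSL phi2 -> OGSL (SLR phi1 phi2)
| OGSL_Goal w b phi :
    binding_prefix b -> Qnt (free (binds b phi)) w -> OGSL phi ->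
    OGSL (quants w (binds b phi)).

Fixpoint subformula (AP Ag : finType) (psi phi : SL AP Ag) : Prop :=
  psi = phi \/
  match phi with
  | SLAtom _ => False
  | SLNot phi1 | SLX phi1 | SLQ _ _ phi1 | SLBind _ _ phi1 =>
      subformula psi phi1
  | SLAnd phi1 phi2 | SLOr phi1 phi2 | SLU phi1 phi2 | SLR phi1 phi2 =>
      subformula psi phi1 \/ subformula psi phi2
  end.

Definition fvs (AP Ag : finType) (phi : SL AP Ag) : Prop :=
  forall a b x psi1 psi2,
    subformula (SLBind a x psi1) phi -> subformula (SLBind b x psi2) phi ->
    a = b.

(* [altq q phi] is the maximal number of switches on a branch of phi, below a
   closest non-vacuous quantifier of kind q (None if there is none).  A
   negation dualizes that kind, so that <<x>> ~ <<y>> is a switch and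
   <<x>> ~ [[y]] is not.  Proper subsentences count as atoms. *)
Fixpoint altq (AP Ag : finType) (q : option bool) (phi : SL AP Ag) : nat :=
  let rec q' psi := if sentence psi then 0 else altq q' psi in
  match phi with
  | SLAtom _ => 0
  | SLNot phi1 => rec (omap negb q) phi1
  | SLX phi1 | SLBind _ _ phi1 => rec q phi1
  | SLAnd phi1 phi2 | SLOr phi1 phi2 | SLU phi1 phi2 | SLR phi1 phi2 =>
      maxn (rec q phi1) (rec q phi2)
  | SLQ k x phi1 =>
      if inl x \in free phi1 then ((q == Some (~~ k)) + rec (Some k) phi1)%N
      else rec q phi1
  end.

Definition alt (AP Ag : finType) (phi : SL AP Ag) : nat := altq None phi.

Definition k_alt (AP Ag : finType) (k : nat) (phi : SL AP Ag) : Prop :=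
  forall psi, subformula psi phi -> alt psi <= k.

(** * ATL* *)

Inductive ATLstate (AP Ag : finType) : Type :=
| SAtom of AP
| SNot of ATLstate AP Ag
| SAnd of ATLstate AP Ag & ATLstate AP Ag
| SCoal of {set Ag} & ATLpath AP Ag
with ATLpath (AP Ag : finType) : Type :=
| PState of ATLstate AP Ag
| PNot of ATLpath AP Ag
| PAnd of ATLpath AP Ag & ATLpath AP Ag
| POr of ATLpath AP Ag & ATLpath AP Ag
| PX of ATLpath AP Ag
| PU of ATLpath AP Ag & ATLpath AP Ag
| PR of ATLpath AP Ag & ATLpath AP Ag.

Definition suffix_path (S : Type) (pi : nat -> S) (i : nat) : nat -> S :=
  fun j => pi (i + j)%N.

(* The agents of A follow f and all other agents follow g. *)
Definition profile (AP Ag : finType) (G : CGS AP Ag) (A : {set Ag})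
    (f g : Ag -> strategy G) : assignment G :=
  fun l => if l is inr a then Some (if a \in A then f a else g a) else None.

Fixpoint satS (AP Ag : finType) (G : CGS AP Ag) (phi : ATLstate AP Ag)
    (s : St G) : Prop :=
  match phi with
  | SAtom p => p \in lab s
  | SNot phi1 => ~ satS phi1 s
  | SAnd phi1 phi2 => satS phi1 s /\ satS phi2 s
  | SCoal A psi =>
      exists f : Ag -> strategy G, (forall a, a \in A -> Str s (f a)) /\
        forall g : Ag -> strategy G, (forall a, a \notin A -> Str s (g a)) ->
          satP psi (play (profile A f g) s)
  end
with satP (AP Ag : finType) (G : CGS AP Ag) (psi : ATLpath AP Ag)
    (pi : nat -> St G) : Prop :=
  match psi with
  | PState phi => satS phi (pi 0)
  | PNot psi1 => ~ satP psi1 pi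
  | PAnd psi1 psi2 => satP psi1 pi /\ satP psi2 pi
  | POr psi1 psi2 => satP psi1 pi \/ satP psi2 pi
  | PX psi1 => satP psi1 (suffix_path pi 1)
  | PU psi1 psi2 =>
      exists i, satP psi2 (suffix_path pi i) /\
        forall j, j < i -> satP psi1 (suffix_path pi j)
  | PR psi1 psi2 =>
      forall i, satP psi2 (suffix_path pi i) \/
        exists2 j, j < i & satP psi1 (suffix_path pi j)
  end.

Definition modelsATL (AP Ag : finType) (G : CGS AP Ag) (phi : ATLstate AP Ag)
    : Prop :=
  satS phi (s0 G).

(* Main.v *)
(** The sentence is [[x]]<<y>>[[z]] (a,x)(b,y)(c,z) X p.  Two one-shot games,
    with a sink for p and a sink for its negation, differ on it and agree on all
    ATL* formulas.  In both of them p holds next iff the choices of a and b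
    agree, the action [None] counting as [Some false], except that in the second
    one a's action [None] makes p depend on the choices of b and c instead;
    against this action no choice of b wins.  The value of the game is
    nevertheless controlled by the same coalitions in both games: a coalition
    that contains a and b can force either value, and any other coalition can
    force neither. *)

Require Import Defs.
From mathcomp Require Import all_boot finmap boolp.

Set Implicit Arguments.
Unset Strict Implicit.
Unset Printing Implicit Defensive.

Scheme ATLstate_path_ind := Induction for ATLstate Sort Prop
with ATLpath_state_ind := Induction for ATLpath Sort Prop.
Combined Scheme ATL_mutind from ATLstate_path_ind, ATLpath_state_ind.

(** * Constant strategies as witnesses *)

Section ConstantStrategies.
Variables (AP Ag : finType) (G : CGS AP Ag).
Implicit Types (s : St G) (c : Ac G).

Definition const_str s c : strategy G :=
  fun rho => if `[< Trk s rho >] then Some c else None.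

Lemma Str_const s c : Str s (const_str s c).
Proof.
move=> rho; rewrite /const_str; case: asboolP => [H|H]; split=> //.
- by move=> _; exists c.
- by case.
Qed.

Lemma const_str1 s c : const_str s c [:: s] = Some c.
Proof. by rewrite /const_str; case: asboolP => // -[]. Qed.

Lemma Str1 s f : Str s f -> exists c, f [:: s] = Some c.
Proof. by move=> /(_ [:: s]) [_]; apply. Qed.

End ConstantStrategies.

(** * The two one-shot games and their ATL* equivalence *)

Section Games.
Variables (AP Ag : finType) (a b c : Ag).
Hypotheses (ab : a != b) (bc : b != c).

Let Act := option bool.
Let choice (m : Act) := odflt false m.

Definition win (k : bool) (d : {ffun Ag -> Act}) : bool :=
  if k && (d a == None) then choice (d b) == choice (d c)
  else choice (d a) == choice (d b).

(** The root is [None] and the sinks are [Some w]. States and actions do not depend on [k], so both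
    games can be compared at the same state and along the same path. *)
Definition one_shot (k : bool) : CGS AP Ag :=
  @MkCGS AP Ag Act (option bool) None
    (fun s => if s == Some true then [set: AP] else set0)
    (fun s d => if s is Some _ then s else Some (win k d))
    None.

Lemma play_sink k (chi : assignment (one_shot k)) w :
  play chi (Some w : St (one_shot k)) = fun=> Some w.
Proof.
apply: funext; elim=> [|i IH] //=.
by rewrite /play /= last_rcons; move: IH; rewrite /play => ->.
Qed.

Definition outcome (w : bool) (i : nat) : option bool :=
  if i is 0 then None else Some w.

Lemma play_root k (chi : assignment (one_shot k)) :
  play chi (None : St (one_shot k)) = outcome (win k (decision chi [:: None])).
Proof.
apply: funext; elim=> [|[|i] IH] //=.
by rewrite /play /= last_rcons; move: IH; rewrite /play /= => ->.
Qed.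

(** Alpha-effectivity of the coalition [A] in the one-step game; the full decision [d] stands for a
    joint action of [A], its values elsewhere being ignored. *)
Definition can_force k (A : {set Ag}) (P : bool -> Prop) : Prop :=
  exists d : {ffun Ag -> Act}, forall d' : {ffun Ag -> Act},
    (forall x, x \in A -> d' x = d x) -> P (win k d').

Let set_act (d : {ffun Ag -> Act}) x m : {ffun Ag -> Act} :=
  [ffun y => if y == x then m else d y].

(** When [a] plays [Some true], the exceptional action [None] is avoided for either [k], and the
    outcome is exactly the choice of [b]. *)
Lemma can_force_of_pair k (A : {set Ag}) v (P : bool -> Prop) :
  a \in A -> b \in A -> P v -> can_force k A P.
Proof.
move=> aA bA Pv; exists [ffun x => if x == a then Some true else Some v] => d' H.
rewrite /win (H _ aA) (H _ bA) !ffunE eqxx [b == a]eq_sym (negbTE ab) andbF /=.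
by case: v Pv {H}.
Qed.

(** An agent among [a] and [b] that lies outside [A] can flip the outcome alone: [a] by avoiding
    [None], and [b] because its choice is compared with that of [a] or of [c] in every case. *)
Lemma can_force_only_pair k (A : {set Ag}) (P : bool -> Prop) :
  ~~ ((a \in A) && (b \in A)) -> can_force k A P -> P true /\ P false.
Proof.
move=> nA [d Hd].
have key x m : x \notin A -> P (win k (set_act d x m)).
  move=> xA; apply: Hd => y yA; rewrite ffunE.
  by case: eqP => // yx; rewrite -yx yA in xA.
have {nA} [aA|bA] : a \notin A \/ b \notin A.
- by case/nandP: nA; auto.
- have := (key a (Some true) aA, key a (Some false) aA).
  rewrite /win !ffunE eqxx [b == a]eq_sym (negbTE ab) andbF /=.
  by case: (choice (d b)) => -[].
- have := (key b (Some true) bA, key b (Some false) bA).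
  rewrite /win !ffunE eqxx (negbTE ab) [c == b]eq_sym (negbTE bc) /=.
  by case: (k && _); [case: (choice (d c))|case: (choice (d a))] => -[].
Qed.

Lemma can_force_indep k k' (A : {set Ag}) (P : bool -> Prop) :
  can_force k A P -> can_force k' A P.
Proof.
move=> H; case: (boolP ((a \in A) && (b \in A))) => [/andP[aA bA]|nA].
- by case: H => d /(_ d (fun _ _ => erefl)); exact: can_force_of_pair.
- have [Pt Pf] := can_force_only_pair nA H.
  by exists [ffun=> None] => d' _; case: (win _ _).
Qed.

Lemma satS_coal_sink k (A : {set Ag}) psi w :
  satS (G := one_shot k) (SCoal A psi) (Some w) <->
  satP (G := one_shot k) psi (fun=> Some w).
Proof.
pose f (x : Ag) := const_str (Some w : St (one_shot k)) None.
have fS x : Str (Some w : St (one_shot k)) (f x) by exact: Str_const.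
split=> /= [[g [_ /(_ f)]]|H].
- by rewrite play_sink; apply.
- by exists f; split=> // g _; rewrite play_sink.
Qed.

(** After one step the play stays in a sink, so a strategy matters only through its value on the
    track [[:: None]]. *)
Lemma satS_coal_root k (A : {set Ag}) psi :
  satS (G := one_shot k) (SCoal A psi) None <->
  can_force k A (fun w => satP (G := one_shot k) psi (outcome w)).
Proof.
pose cst (d : {ffun Ag -> Act}) x :=
  const_str (None : St (one_shot k)) (d x : Ac (one_shot k)).
have cstS d x : Str (None : St (one_shot k)) (cst d x) by exact: Str_const.
split=> /= [[f [_ H]]|[d H]].
(* The default [None] is the [ac0] of [one_shot], so this agrees with [decision] even where [f x] is
   undefined. *)
- exists [ffun x => odflt None (f x [:: None])] => d' Hd'.
  have := H (cst d') (fun x _ => cstS d' x); rewrite play_root.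
  suff -> : decision (profile A f (cst d')) [:: None] = d' by [].
  apply/ffunP=> x; rewrite ffunE /=.
  case: ifP => [xA|_]; last by rewrite /cst const_str1.
  by rewrite Hd' // ffunE.
- exists (cst d); split=> // g _; rewrite play_root; apply: H => x xA.
  by rewrite ffunE /= xA /cst const_str1.
Qed.

(** Only coalition formulas at the root consult [win], and there [can_force_indep] applies. Path
    formulas range over arbitrary sequences of states, so the induction hypothesis covers
    suffixes. *)
Lemma ATL_indep k k' :
  (forall (phi : ATLstate AP Ag) (s : option bool),
     satS (G := one_shot k) phi s <-> satS (G := one_shot k') phi s) /\
  (forall (psi : ATLpath AP Ag) (pi : nat -> option bool),
     satP (G := one_shot k) psi pi <-> satP (G := one_shot k') psi pi).
Proof.
apply: (@ATL_mutind AP Ag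
  (fun phi => forall s : option bool,
     satS (G := one_shot k) phi s <-> satS (G := one_shot k') phi s)
  (fun psi => forall pi : nat -> option bool,
     satP (G := one_shot k) psi pi <-> satP (G := one_shot k') psi pi)).
- by [].
- by move=> phi IH s; have := IH s; rewrite /=; tauto.
- by move=> phi1 IH1 phi2 IH2 s; have := (IH1 s, IH2 s); rewrite /=; tauto.
- move=> A psi IH [w|].
  + by split=> /satS_coal_sink /IH H; apply/satS_coal_sink.
  + split=> /satS_coal_root /can_force_indep F; apply/satS_coal_root.
      by case: (F k') => d H; exists d => d' /H /IH.
    by case: (F k) => d H; exists d => d' /H /IH.
- by move=> phi IH pi; exact: IH.
- by move=> psi IH pi; have := IH pi; rewrite /=; tauto.
- by move=> psi1 IH1 psi2 IH2 pi; have := (IH1 pi, IH2 pi); rewrite /=; tauto.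
- by move=> psi1 IH1 psi2 IH2 pi; have := (IH1 pi, IH2 pi); rewrite /=; tauto.
- by move=> psi IH pi; exact: IH.
- move=> psi1 IH1 psi2 IH2 pi.
  by split=> -[i [/IH2 Hi Hj]]; exists i; split=> // j /Hj /IH1.
- move=> psi1 IH1 psi2 IH2 pi.
  by split=> H i; (case: (H i) => [/IH2|[j ji /IH1]]; [left|right; exists j]).
Qed.

End Games.

(** * The sentence, its membership in the fragment, and its truth value in each game *)

Section Sentence.
Variables (AP Ag : finType) (p : AP) (a b c : Ag).
Hypotheses (ab : a != b) (bc : b != c) (ac : a != c).
Hypothesis agentsE : forall x : Ag, [|| x == a, x == b | x == c].

Local Open Scope fset_scope.

Definition quantifiers : seq (bool * nat) := [:: (false, 0); (true, 1); (false, 2)].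
Definition bindings : seq (Ag * nat) := [:: (a, 0); (b, 1); (c, 2)].
Definition aea_next : SL AP Ag :=
  quants quantifiers (binds bindings (SLX (SLAtom p))).

Lemma in_all_agents (x : Ag) : (inr x : nat + Ag) \in all_agents Ag.
Proof. by apply/imfsetP; exists x => //=; rewrite mem_enum. Qed.

Lemma inl_all_agents (x : nat) : ((inl x : nat + Ag) \in all_agents Ag) = false.
Proof. by apply/negbTE/negP => /imfsetP[]. Qed.

Let inr_eq (x y : Ag) : ((inr x : nat + Ag) == inr y) = (x == y).
Proof. by []. Qed.

Let inl_eq (x y : nat) : ((inl x : nat + Ag) == inl y) = (x == y).
Proof. by []. Qed.

Lemma free_bindings :
  free (binds bindings (SLX (SLAtom p))) = [fset inl 0; inl 1; inl 2].
Proof.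
(* Each conditional in [free] takes its first branch: the agent being bound differs from those
   already removed. *)
do 3!rewrite /= ?(in_fsetE, in_all_agents, inr_eq, ab, bc, ac).
apply/fsetP=> -[x|x]; rewrite !(in_fsetE, inl_all_agents, in_all_agents) //=.
  by rewrite !inl_eq !orbF !orbA.
rewrite !inr_eq; have := agentsE x.
by case: (x == a); case: (x == b); case: (x == c).
Qed.

Lemma aea_next_sentence : sentence aea_next.
Proof.
rewrite /sentence /aea_next.
have -> : free (quants quantifiers (binds bindings (SLX (SLAtom p)))) =
  free (binds bindings (SLX (SLAtom p))) `\ inl 2 `\ inl 1 `\ inl 0 by [].
rewrite free_bindings; apply/eqP/fsetP => -[x|x]; rewrite !in_fsetE //= !inl_eq.
by case: x => [|[|[|]]].
Qed.

Lemma aea_next_OGSL : OGSL aea_next.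
Proof.
apply: OGSL_Goal; last by do 2!constructor.
- have enumE : perm_eq (enum Ag) [:: a; b; c].
    apply: uniq_perm; rewrite ?enum_uniq //= ?inE ?negb_or ?ab ?bc ?ac //.
    by move=> x; rewrite mem_enum !inE agentsE.
  split=> [|x /=]; first by rewrite cardE (perm_size enumE).
  rewrite addn0; have := agentsE x.
  have : uniq [:: a; b; c] by rewrite /= !inE negb_or ab ac bc.
  move=> /(count_uniq_mem x); rewrite !inE /= addn0 => -> ->.
  by [].
- split=> //; rewrite free_bindings; apply/fsetP=> y.
  rewrite !in_fsetE; apply/idP/imfsetP => [|[x /=]].
    by rewrite -orbA => /or3P[] /eqP ->; [exists 0|exists 1|exists 2].
  by rewrite !inE => /or3P[] /eqP -> ->; rewrite eqxx ?orbT.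
Qed.

Lemma aea_next_fvs : fvs aea_next.
Proof.
move=> x y n psi1 psi2 /=.
(* Each variable occurs in a single binding, so it determines the agent. *)
do ?[case=> //]; move=> [-> -> _]; do ?[case=> //]; by move=> [].
Qed.

Lemma aea_next_2alt : k_alt 2 aea_next.
Proof.
move=> psi /=.
(* The tests for sentences and vacuous quantifiers need not be evaluated: three quantifiers make at
   most two switches in every branch. *)
do ?[case=> [->|]]; rewrite /alt //=; by repeat case: ifP => _ //=.
Qed.

(** In the first game [b] copies the action of [a]; in the second one [a] plays [None] and [c]
    answers with the opposite of the choice of [b]. *)
Lemma aea_next_one_shotE k :
  models (one_shot AP a b c k) aea_next <-> k = false.
Proof.
pose G := one_shot AP a b c k.
pose cst m := const_str (None : St G) (m : Ac G).
have cstS m : Str (None : St G) (cst m) by exact: Str_const.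
have -> : models G aea_next <->
    forall x : option bool, exists y, forall z,
      win a b c k [ffun i => if i == a then x else if i == b then y else z].
  have satE f g h x y z :
      f [:: None] = Some x -> g [:: None] = Some y -> h [:: None] = Some z ->
      sat (binds bindings (SLX (SLAtom p)))
        (upd (upd (upd (@empty_asg AP Ag G) (inl 0) (Some f)) (inl 1) (Some g))
          (inl 2) (Some h)) (None : St G) <->
      win a b c k [ffun i => if i == a then x else if i == b then y else z].
    move=> fx gy hz.
    rewrite /= /play /=.
    set d := decision _ _.
    have -> : d = [ffun i => if i == a then x else if i == b then y else z].
      apply/ffunP=> i; rewrite !ffunE /upd !inr_eq.
      have := agentsE i.
      case: (eqVneq i a) => [->|_]; first by rewrite (negbTE ab) (negbTE ac) /= fx.
      case: (eqVneq i b) => [->|_]; first by rewrite (negbTE bc) /= gy.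
      by move=> /= ->; rewrite /= hz.
    by case: (win _ _ _ _ _); rewrite ?inE.
  split=> [H x|H f fS].
  - have [g [gS Hg]] := H (cst x) (cstS x).
    have [y gy] := Str1 gS; exists y => z.
    apply/(satE (cst x) g (cst z) x y z (const_str1 _ _) gy (const_str1 _ _)).
    exact: Hg.
  - have [x fx] := Str1 fS; have [y Hy] := H x.
    exists (cst y); split=> // h /Str1[z hz].
    exact/(satE f (cst y) h x y z fx (const_str1 _ _) hz).
have ba : b == a = false by rewrite eq_sym (negbTE ab).
have ca : c == a = false by rewrite eq_sym (negbTE ac).
have cb : c == b = false by rewrite eq_sym (negbTE bc).
have winE x y z :
    win a b c k [ffun i => if i == a then x else if i == b then y else z] =
    if k && (x == None) then odflt false y == odflt false z
    else odflt false x == odflt false y.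
  by rewrite /win !ffunE !eqxx ba ca cb.
split=> [/(_ None) [y]|k0 x].
- case: k winE {G cst cstS} => // winE.
  by move=> /(_ (Some (~~ odflt false y))); rewrite winE; case: y => [[]|].
- by exists x => z; rewrite winE k0 eqxx.
Qed.

End Sentence.

Theorem theorem4p4 (AP Ag : finType) (hAP : 0 < #|AP|) (hAg : #|Ag| = 3) :
  exists phi : SL AP Ag,
    [/\ OGSL phi, sentence phi, fvs phi & k_alt 2 phi] /\
    forall phi' : ATLstate AP Ag,
      exists G : CGS AP Ag, ~ (models G phi <-> modelsATL G phi').
Proof.
have /card_gt0P[p _] := hAP.
have [a [b [c [ab bc ac agentsE]]]] : exists a b c : Ag,
    [/\ a != b, b != c, a != c & forall x, [|| x == a, x == b | x == c]].
  have := enum_uniq Ag; have := mem_enum Ag; move: hAg; rewrite cardE.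
  case: (enum Ag) => [|a [|b [|c []]]] //= _ E.
  rewrite !inE !negb_or => /and3P[/andP[ab ac] bc _].
  by exists a, b, c; split=> // x; have := E x; rewrite !inE.
exists (aea_next p a b c); split.
  split; [exact: aea_next_OGSL|exact: aea_next_sentence|exact: aea_next_fvs|].
  exact: aea_next_2alt.
move=> phi'.
have E k := aea_next_one_shotE p ab bc ac agentsE k.
have [I _] := @ATL_indep AP Ag a b c ab bc true false.
(* The sentence is true in the game for [false]. If [phi'] is too, it carries over to the game for
   [true], where the sentence fails. *)
have [H|H] := pselect (modelsATL (one_shot AP a b c false) phi').
- exists (one_shot AP a b c true) => -[_ M].
  by have /E : models (one_shot AP a b c true) (aea_next p a b c) by exact/M/I.
- exists (one_shot AP a b c false) => -[M _].
  by apply/H/M/E.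
Qed.
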